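(* For every integer $r \geq 3$ there is a constant $a(r)>0$ such that for every integer $m \geq 5r^2$ and every integer $0 \leq f \leq \binom{m}{r}$, and for all large enough $n$, every $n$-vertex $r$-graph with no $(m,f)$-subset contains a homogeneous set of size at least $\big(\log_{(r-2)}(n)\big)^{\frac{a(r)}{m}}$.
   Context: An $r$-graph is an $r$-uniform hypergraph. A homogeneous set in an $r$-graph is a vertex set that is either a clique (all its $r$-subsets are edges) or an independent set (none of its $r$-subsets is an edge). An $(m,f)$-subset of a hypergraph is a set of $m$ vertices which induces exactly $f$ edges. $\log_{(k)}$ denotes the $k$-th iterated logarithm: $\log_{(1)}(x)=\log x$ and $\log_{(k)}(x)=\log(\log_{(k-1)}(x))$; logarithms are base 2. ''Large enough $n$'' may depend on $r,m,f$. *)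

(* Defs.v *)
From mathcomp Require Import all_boot all_order all_algebra.
From mathcomp Require Import all_classical all_reals all_analysis.

Set Implicit Arguments.
Unset Strict Implicit.
Unset Printing Implicit Defensive.

Import Order.TTheory GRing.Theory Num.Theory.

Record uniform_hypergraph (r : nat) (V : finType) := UniformHypergraph {
  edges : {set {set V}};
  edges_uniform : forall e : {set V}, e \in edges -> #|e| = r
}.

Section Hypergraphs.
Variables (r : nat) (V : finType) (H : uniform_hypergraph r V).

Definition induced_edges (S : {set V}) : {set {set V}} :=
  [set e in edges H | e \subset S].

Definition mf_subset (m f : nat) (S : {set V}) : Prop :=
  #|S| = m /\ #|induced_edges S| = f.

Definition clique (S : {set V}) : Prop :=
  forall e : {set V}, e \subset S -> #|e| = r -> e \in edges H.

Definition independent (S : {set V}) : Prop :=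
  forall e : {set V}, e \subset S -> #|e| = r -> e \notin edges H.

Definition homogeneous (S : {set V}) : Prop := clique S \/ independent S.

End Hypergraphs.

Section IteratedLog.
Variable R : realType.
Local Open Scope ring_scope.

(* [ln] is total, with value 0 on nonpositive reals, so [iter_log2 k x] is the
   usual iterated logarithm only once [x] is large enough in terms of [k]. *)
Definition log2 (x : R) : R := ln x / ln 2.

Definition iter_log2 (k : nat) (x : R) : R := iter k log2 x.

End IteratedLog.

(* Main.v *)
Require Import Defs.
From mathcomp Require Import all_boot all_order all_algebra.
From mathcomp Require Import all_classical all_reals all_analysis.
From mathcomp Require Import zify ring.

Set Implicit Arguments.
Unset Strict Implicit.
Unset Printing Implicit Defensive.

Import Order.TTheory GRing.Theory Num.Theory.

(** Write r = k + 2.  Iterating the Erdos-Rado argument r - 2 times costs r - 2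
    exponentials and leaves a sequence of vertices on which membership of an
    r-set in the hypergraph depends only on its first two vertices: an ordered
    graph G on t vertices, with t a fixed power of the (r - 2)-fold iterated
    logarithm of n ([first_two_determine]).  The usual last step, down to one
    vertex, would cost one more exponential; it is replaced by the absence of
    (m, f)-subsets.

    If t >= h ^ m and G has no homogeneous set of size h, then G contains every
    caterpillar on m vertices ([constant_or_realizes]): a vertex set that can be
    peeled off one vertex at a time, each time the first or the last one left, so
    that this vertex is joined to all or to none of the others left, where side
    and adjacency are prescribed in advance.  The reason is that if no vertex of a
    set of size h * D had D neighbours to its right, a greedy choice would give an
    independent set of size h.  The number of hyperedges that a caterpillar spans
    is the sum of weights [weight], one for each vertex joined to the others.

    It remains to find, for m >= 5 r ^ 2 and every f <= 'C(m, r), a caterpillar on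
    m vertices with weight f ([all_attainable]).  Put d = r - 1.
    - Small f.  Take n maximal with 'C(n, r) <= f and write f - 'C(n, r) greedily
      as a sum of t_i copies of 'C(i, d), i < n.  The complete caterpillar on n
      vertices contributes 'C(n, r); inserting a left vertex joined to none of the
      vertices left, when i vertices have been peeled off on the right, contributes
      'C(i, d) ([weight_digit_word]).  The greedy expansion has about d * log n digits
      ([greedy_digits]), so few vertices are added.
    - Growth.  If all f < B are attained on m vertices and 'C(m, d) <= B, then
      all f < B + 'C(m, d) are attained on m + 1 vertices: add a first vertex joined
      to none or to all ([attainable_extend]).  For the start the choice of about
      4 d ^ 2 vertices works ([leq_bin_shift]).
    - Large f.  Complementing the graph replaces f by 'C(m, r) - f; the two
      ranges overlap because 5 r ^ 2 exceeds 4 d ^ 2 by a factor that doubles the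
      binomial coefficient ([double_bin]).

    So h ^ m <= t forces a homogeneous set of size h, which gives an exponent
    proportional to 1 / m. *)

(** * Inequalities between powers and binomial coefficients *)

(** Bernoulli's inequality (1 + 1/a)^k >= 1 + k/a without fractions. *)
Lemma bernoulli a k : a ^ k * (a + k) <= a * a.+1 ^ k.
Proof.
elim: k => [|k IH]; first by rewrite !expn0 mul1n muln1 addn0.
rewrite !expnS.
have : a.+1 * (a ^ k * (a + k)) <= a.+1 * (a * a.+1 ^ k) by rewrite leq_mul2l IH orbT.
by move: (a ^ k) (a.+1 ^ k) => u v; nia.
Qed.

Lemma two_expn_leq n : 0 < n -> 2 * n ^ n <= n.+1 ^ n.
Proof.
move=> n0; have := bernoulli n n.
by move: (n ^ n) (n.+1 ^ n) => u v; nia.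
Qed.

(** The companion bound (1 + 1/a)^i <= 1 / (1 - i / (a + 1)), without fractions. *)
Lemma expnS_leq a i : a.+1 ^ i * (a.+1 - i) <= a ^ i * a.+1.
Proof.
elim: i => [|i IH]; first by rewrite !expn0 subn0.
rewrite !expnS.
have h : a.+1 * (a.+1 - i.+1) <= a * (a.+1 - i) by nia.
have : a.+1 ^ i * (a.+1 * (a.+1 - i.+1)) <= a.+1 ^ i * (a * (a.+1 - i)) by rewrite leq_mul2l h orbT.
move: h IH; move: (a ^ i) (a.+1 ^ i) (a.+1 - i) (a.+1 - i.+1) => u v w z; nia.
Qed.

(** (1 + 1/N)^N <= 4 for N = 2 n: the previous bound with i = n gives 2 for half
    of the exponent. *)
Lemma expnS_leq4 n : (2 * n).+1 ^ (2 * n) <= 4 * (2 * n) ^ (2 * n).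
Proof.
have h : (2 * n).+1 ^ n <= 2 * (2 * n) ^ n.
  have := expnS_leq (2 * n) n.
  by move: (_ ^ n) ((2 * n) ^ n) => u v; nia.
by rewrite mulnC !expnM -[4]/(2 ^ 2) -expnMn leq_sqr; rewrite mulnC in h.
Qed.

Lemma sqr_leq_exp2 d : d ^ 2 <= 2 ^ d.+1.
Proof.
elim: d => // d IH; case: d IH => // -[|[|d]] //= IH.
rewrite expnS; apply: leq_trans (_ : 2 * d.+3 ^ 2 <= _); last by rewrite leq_mul2l IH.
by nia.
Qed.

Lemma leq_expn_root n a b : 0 < n -> a ^ n <= b ^ n -> a <= b.
Proof. by move=> n0; rewrite leq_exp2r. Qed.

(** 'C(a, k) / 'C(b, k) is a product of k ratios; if each of them is at most
    p / q, the quotient is at most (p / q)^k. *)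
Lemma bin_ratio_ffact a b p q k : (forall i, i < k -> (a - i) * q <= p * (b - i)) ->
  a ^_ k * q ^ k <= p ^ k * b ^_ k.
Proof.
elim: k => [|k IH] h; first by rewrite !ffactn0 !expn0.
have IH' := IH (fun i hi => h i (ltnW hi)).
have := leq_mul IH' (h k (leqnn _)); rewrite !ffactnSr !expnSr => H.
by rewrite mulnACA (leq_trans H) // mulnACA.
Qed.

Lemma bin_ratio a b p q k : (forall i, i < k -> (a - i) * q <= p * (b - i)) ->
  'C(a, k) * q ^ k <= p ^ k * 'C(b, k).
Proof.
move/bin_ratio_ffact; rewrite -!bin_ffact => h.
by rewrite -(leq_pmul2r (fact_gt0 k)) mulnAC -[leqRHS]mulnA.
Qed.

(** m / M >= 1 + 1/r suffices since (1 + 1/r)^r >= 2. *)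
Lemma double_bin r M m : 0 < r -> M * r.+1 <= m * r -> 2 * 'C(M, r) <= 'C(m, r).
Proof.
move=> r0 h.
have H : 'C(M, r) * r.+1 ^ r <= r ^ r * 'C(m, r) by apply: bin_ratio => i _; nia.
rewrite -(@leq_pmul2l (r ^ r)) ?expn_gt0 ?r0 //.
apply: leq_trans H.
by rewrite mulnA [_ * 2]mulnC mulnC leq_mul2l two_expn_leq ?orbT.
Qed.

Lemma leq_binS m d : 2 * d.+1 <= m.+1 -> 'C(m, d) <= 'C(m, d.+1).
Proof.
move=> h; rewrite -(leq_pmul2l (ltn0Sn d)) mul_bin_left leq_mul2r; apply/orP; right; lia.
Qed.

(** Enlarging d + v by x = O(d * log v) multiplies 'C(_, d) by at most
    (1 + x / v)^d, whereas passing from d to d.+1 multiplies it by v / d.+1.  With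
    v = (2 d)^2 the exponents match: (1 + x / v)^v <= 4^x <= v^(2 d), and since
    v = 4 d * d, taking 4 d-th roots gives (1 + x / v)^d <= 2 d <= v / d.+1. *)
Lemma leq_bin_shift d x v : 0 < d -> v = (2 * d) ^ 2 -> 2 ^ x <= v ^ d ->
  'C(d + v + x, d) <= 'C(d + v, d.+1).
Proof.
move=> d0 vE hx.
have v0 : 0 < v by rewrite vE expn_gt0 muln_gt0 d0.
have ev : v = 2 * (2 * d ^ 2) by rewrite vE; nia.
have h1 : (v + x) ^ v <= 4 ^ x * v ^ v.
  have := bernoulli v x; rewrite -(leq_exp2r _ _ v0) !expnMn => h.
  have h4 : (v.+1 ^ x) ^ v <= 4 ^ x * (v ^ x) ^ v.
    have [-> | x0] := posnP x; first by rewrite !expn0 exp1n mul1n.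
    have h4 := expnS_leq4 (2 * d ^ 2); rewrite -ev -(leq_exp2r _ _ x0) expnMn in h4.
    by rewrite -!expnM [x * v]mulnC !expnM.
  rewrite -(@leq_pmul2l ((v ^ x) ^ v)) ?expn_gt0 ?v0 // (leq_trans h) //.
  rewrite mulnC mulnCA mulnA leq_mul2r; apply/orP; right; lia.
have h2 : (v + x) ^ d <= 2 * d * v ^ d.
  apply: (@leq_expn_root (4 * d)); first lia.
  rewrite -expnM (_ : d * (4 * d) = v); last by rewrite vE; nia.
  apply: (leq_trans h1); rewrite expnMn -expnM (_ : d * (4 * d) = v); last by rewrite vE; nia.
  rewrite leq_mul2r; apply/orP; right.
  rewrite (_ : 4 = 2 ^ 2) // -expnM mulnC expnM.
  apply: (@leq_trans ((v ^ d) ^ 2)); first by rewrite leq_sqr.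
  by rewrite vE -!expnM leq_pexp2l ?muln_gt0 ?d0 //; nia.
have h3 : 'C(d + v + x, d) * v ^ d <= (v + x) ^ d * 'C(d + v, d).
  by apply: bin_ratio => i hi; rewrite mulnC; nia.
rewrite -(leq_pmul2l (ltn0Sn d)) mul_bin_left.
rewrite -(@leq_pmul2r (v ^ d)) ?expn_gt0 ?v0 //.
have -> : d + v - d = v by lia.
apply: (@leq_trans (d.+1 * (2 * d * v ^ d * 'C(d + v, d)))).
  rewrite -mulnA leq_mul2l (leq_trans h3) // leq_mul2r h2 ?orbT //.
have -> : v * 'C(d + v, d) * v ^ d = v * (v ^ d * 'C(d + v, d)) by lia.
rewrite -[2 * d * _ * _]mulnA mulnA leq_mul2r; apply/orP; right.
by rewrite vE; nia.
Qed.

(** * Caterpillar words and their weights *)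

(** A word prescribes how a set of vertices is peeled off: each letter says which
    extreme vertex goes next, and whether it is joined to all (true) or to none
    (false) of the vertices that remain. *)
Variant side := Leftmost | Rightmost.
Definition word := seq (side * bool).

(** The number of (k + 2)-sets whose first two elements are adjacent, when the
    caterpillar is followed by q further vertices that may only serve as third
    or later elements: a vertex joined to the others is the first element of
    such pairs if it is leftmost, the second if it is rightmost. *)
Fixpoint weight k (w : word) q : nat :=
  match w with
  | [::] => 0
  | (Leftmost, b) :: w' => b * ('C(size w' + q, k.+1) - 'C(q, k.+1)) + weight k w' q
  | (Rightmost, b) :: w' => b * (size w' * 'C(q, k)) + weight k w' q.+1
  end.

Definition negw (w : word) : word := [seq (x.1, ~~ x.2) | x <- w].

(** The right-hand side counts all (k + 2)-sets; the last two summands on the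
    left are those with at most one element in the caterpillar. *)
Lemma weight_negw k w q :
  weight k (negw w) q + weight k w q + 'C(q, k.+2) + size w * 'C(q, k.+1) = 'C(size w + q, k.+2).
Proof.
elim: w q => [|[[] b] w IH] q /=; first by rewrite !addn0.
- have := IH q; rewrite size_map addSn binS.
  have : 'C(q, k.+1) <= 'C(size w + q, k.+1) by apply: leq_bin2l; lia.
  case: b; nia.
- have := IH q.+1; rewrite size_map addSn addnS !binS.
  case: b; nia.
Qed.

(** With all right vertices joined, a left vertex that is peeled off after i right
    vertices and joined to none of the vertices left enlarges the degree of those
    i right vertices by one, which adds 'C(i, k + 1) sets.  So the entry t_i of ds
    is the number of such left vertices inserted at that moment. *)
Fixpoint digit_word (ds : seq nat) : word :=
  if ds is t :: ds' then nseq t (Leftmost, false) ++ (Rightmost, true) :: digit_word ds' else [::].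

Fixpoint digit_value k (ds : seq nat) q :=
  if ds is t :: ds' then t * 'C(q, k) + digit_value k ds' q.+1 else 0.

Lemma size_digit_word ds : size (digit_word ds) = size ds + sumn ds.
Proof. by elim: ds => //= t ds IH; rewrite size_cat size_nseq /= IH; lia. Qed.

Lemma weight_skip k t w q : weight k (nseq t (Leftmost, false) ++ w) q = weight k w q.
Proof. by elim: t. Qed.

Lemma weight_digit_word k ds q :
  weight k (digit_word ds) q + 'C(q, k.+2) + (size ds + sumn ds) * 'C(q, k.+1)
  = 'C(q + size ds, k.+2) + digit_value k.+1 ds q.
Proof.
elim: ds q => [|t ds IH] q /=; first by rewrite !addn0.
have := IH q.+1; rewrite weight_skip /= size_digit_word addSnnS !binS mul1n.
by nia.
Qed.

Lemma digit_value_rcons k ds t q :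
  digit_value k (rcons ds t) q = digit_value k ds q + t * 'C(q + size ds, k).
Proof.
elim: ds q => [|u ds IH] q /=; first by rewrite !addn0.
by rewrite IH addSnnS addnA. Qed.

Lemma digit_value_nseq0 k n q : digit_value k (nseq n 0) q = 0.
Proof. by elim: n q => //= n IH q; rewrite IH. Qed.

Lemma leq_expn2r n a b : a <= b -> a ^ n <= b ^ n.
Proof. by case: n => // n; rewrite leq_exp2r. Qed.

Lemma two_pow_step j x y : j.+1 * x = y -> 2 ^ x * j.+1 ^ y <= j.+2 ^ y.
Proof. by move=> <-; rewrite !expnM -expnMn leq_expn2r // two_expn_leq. Qed.

Lemma bin_increment d j :
  j.+1 * ('C(d + j.+1, d) - 'C(d + j, d)) = d * 'C(d + j, d).
Proof.
have := mul_bin_down (d + j.+1) d; rewrite addnS /= -addnS addKn mulnBr; nia.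
Qed.

(** The digit sum s of the greedy expansion satisfies
    s <= d * log2 (j + 1) + rho / c with c = 'C(d + j, d) the largest weight;
    the conclusion is this bound, exponentiated and raised to the power c.  The
    linear term rho / c absorbs the leading digit exactly.  The remainder
    rho' < c has to be compared with the next smaller weight c0, and the loss
    rho' * (1 / c0 - 1 / c) <= c / c0 - 1 = d / j is paid for by the growth of
    d * log2, because log2 (1 + 1 / j) >= 1 / j. *)
Lemma greedy_digits_potential d j rho (c := 'C(d + j, d)) : rho < 'C(d + j.+1, d) ->
  exists ds, [/\ size ds = d + j.+1, digit_value d ds 0 = rho
    & (2 ^ sumn ds) ^ c <= (j.+1 ^ d) ^ c * 2 ^ rho].
Proof.
rewrite {}/c; elim: j rho => [|j IH] rho hr.
  exists (rcons (nseq d 0) rho).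
  rewrite size_rcons size_nseq addn1 digit_value_rcons size_nseq add0n binn muln1.
  by rewrite digit_value_nseq0 addn0 binn !expn1 exp1n mul1n sumn_rcons sumn_nseq mul0n.
set c := 'C(d + j.+1, d) in IH hr *; set c0 := 'C(d + j, d) in IH *.
have c_gt0 : 0 < c by rewrite bin_gt0 leq_addr.
have c0_gt0 : 0 < c0 by rewrite bin_gt0 leq_addr.
have dE : j.+1 * (c - c0) = d * c0 := bin_increment d j.
have [ds [sz val bd]] := IH (rho %% c) (ltn_pmod _ c_gt0).
exists (rcons ds (rho %/ c)); rewrite size_rcons sz digit_value_rcons val sz add0n; split.
- by lia.
- by rewrite -/c addnC -divn_eq.
rewrite sumn_rcons.
have hpow : 2 ^ (c * (c - c0)) * j.+1 ^ (d * c0 * c) <= j.+2 ^ (d * c0 * c).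
  by apply: two_pow_step; rewrite mulnCA dE mulnC.
apply: (@leq_expn_root c0) => //.
set t := rho %/ c; set s := rho %% c in bd *.
have sc : s <= c by rewrite ltnW // ltn_pmod.
have bd' : 2 ^ (sumn ds * c0 * c) <= j.+1 ^ (d * c0 * c) * 2 ^ (s * c).
  by have := leq_expn2r c bd; rewrite expnMn -!expnM !mulnA.
have hs : 2 ^ (s * c) <= 2 ^ (s * c0) * 2 ^ (c * (c - c0)).
  rewrite -expnD leq_exp2l //.
  have := leq_mul sc (leqnn (c - c0)); rewrite mulnBr; nia.
have -> : ((j.+2 ^ d) ^ c * 2 ^ rho) ^ c0 = j.+2 ^ (d * c0 * c) * (2 ^ (t * c * c0) * 2 ^ (s * c0)).
  by rewrite (divn_eq rho c) expnMn -!expnM -expnD mulnDl; do 2?f_equal; lia.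
have -> : ((2 ^ (sumn ds + t)) ^ c) ^ c0 = 2 ^ (t * c * c0) * 2 ^ (sumn ds * c0 * c).
  by rewrite -!expnM -expnD; f_equal; lia.
move: hpow bd' hs.
move: (2 ^ (t * c * c0)) (2 ^ (sumn ds * c0 * c)) (2 ^ (s * c)) (2 ^ (s * c0)) (2 ^ (c * (c - c0)))
  (j.+1 ^ _) (j.+2 ^ _) => a1 a2 a3 a4 a5 a6 a7 h1 h2 h3.
rewrite mulnCA leq_mul2l; apply/orP; right.
apply: leq_trans h2 _; apply: (@leq_trans (a6 * (a4 * a5))); first by rewrite leq_mul2l h3 orbT.
by rewrite mulnCA mulnC leq_mul2r mulnC h1 orbT.
Qed.

Lemma greedy_digits d j rho : rho < 'C(d + j.+1, d) ->
  exists ds, [/\ size ds = d + j.+1, digit_value d ds 0 = rho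
    & 2 ^ sumn ds <= 2 * j.+2 ^ d].
Proof.
move=> hr; have [ds [sz val bd]] := greedy_digits_potential hr.
exists ds; split => //.
set c := 'C(d + j.+1, d) in hr; set c0 := 'C(d + j, d) in bd.
have c0_gt0 : 0 < c0 by rewrite bin_gt0 leq_addr.
apply: (@leq_expn_root c0) => //; apply: (leq_trans bd).
have dE : j.+1 * (c - c0) = d * c0 := bin_increment d j.
have c0c : c0 <= c by apply: leq_bin2l; lia.
have := two_pow_step dE; rewrite expnMn -!expnM => h.
apply: (@leq_trans (j.+1 ^ (d * c0) * 2 ^ c));
  first by rewrite leq_mul2l leq_exp2l ?(ltnW hr) ?orbT.
have -> : 2 ^ c = 2 ^ c0 * 2 ^ (c - c0) by rewrite -expnD subnKC.
by rewrite mulnCA leq_mul2l [X in X <= _]mulnC h orbT.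
Qed.

(** * Attainable numbers of edges *)

Definition attainable k m f := exists2 w, size w = m & weight k w 0 = f.

Lemma attainable_skip k m m' f : m <= m' -> attainable k m f -> attainable k m' f.
Proof.
move=> mm' [w sw wf]; exists (nseq (m' - m) (Leftmost, false) ++ w).
  by rewrite size_cat size_nseq sw subnK.
by rewrite weight_skip.
Qed.

Lemma attainable_add k m f : attainable k m f -> attainable k m.+1 (f + 'C(m, k.+1)).
Proof.
move=> [w sw wf]; exists ((Leftmost, true) :: w) => /=; first by rewrite sw.
by rewrite mul1n addn0 sw wf bin0n subn0 addnC.
Qed.

Lemma attainable_compl k m f : attainable k m f -> attainable k m ('C(m, k.+2) - f).
Proof.
move=> [w sw wf]; exists (negw w); first by rewrite size_map.
have := weight_negw k w 0; rewrite sw wf !bin0n /= muln0 !addn0; lia.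
Qed.

(** The largest n with 'C(n, d + 1) <= f leaves a remainder below 'C(n, d), whose
    greedy digits have sum at most x + 1; the additional 1 is absorbed by
    n < d + v.  The choice x = trunc_log 2 (v ^ d) satisfies the hypothesis. *)
Lemma attainable_small k x (d := k.+1) (v := (2 * d) ^ 2) f :
  v ^ d < 2 ^ x.+1 -> f < 'C(d + v, d.+1) -> attainable k (d + v + x) f.
Proof.
move=> hx hf.
have v0 : 0 < v by rewrite expn_gt0.
have [n] : exists n, 'C(n, d.+1) <= f < 'C(n.+1, d.+1).
  have ex : exists n, f < 'C(n, d.+1) by exists (d + v).
  have := ex_minnP ex; case=> -[|n]; first by rewrite bin0n.
  move=> h1 h2; exists n; rewrite h1 andbT leqNgt; apply/negP => /h2.
  by rewrite ltnn.
rewrite binS => /andP[lo hi].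
have nN : n < d + v.
  rewrite ltnNge; apply/negP => h.
  by have := leq_trans (leq_bin2l d.+1 h) lo; rewrite leqNgt hf.
have [nd | nd] := leqP n d.
  have f0 : f = 0.
    case: (ltngtP n d) nd => // h _; last by move: hi; rewrite h binn bin_small //; lia.
    by move: hi; rewrite !bin_small //; lia.
  rewrite f0; apply: (@attainable_skip k 0) => //.
  by exists [::].
have nE : n = d + (n - d.+1).+1 by lia.
have hr : f - 'C(n, d.+1) < 'C(d + (n - d.+1).+1, d) by rewrite -nE; lia.
have [ds [sz val bd]] := greedy_digits hr.
have sx : sumn ds <= x.+1.
  have : 2 ^ sumn ds < 2 ^ x.+2.
    apply: (leq_ltn_trans bd); rewrite expnS ltn_pmul2l //; apply: leq_ltn_trans hx.
    by apply: leq_expn2r; lia.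
  by rewrite ltn_exp2l.
apply: (@attainable_skip k (n + sumn ds)); first by lia.
exists (digit_word ds); first by rewrite size_digit_word sz -nE.
have := weight_digit_word k ds 0.
by rewrite !bin0n /= muln0 !addn0 add0n sz -nE -/d val => ->; rewrite subnKC.
Qed.

(** A first vertex joined to all others adds 'C(m, d), so an initial interval of
    attainable values at least that long grows by 'C(m, d); it stays long enough
    because 'C(m + 1, d) <= 2 * 'C(m, d) in this range. *)
Lemma attainable_extend k M m B (d := k.+1) : 2 * d <= M.+1 -> 'C(M, d) <= B ->
  (forall f, f < B -> attainable k M f) -> M <= m ->
  forall f, f < B + ('C(m, d.+1) - 'C(M, d.+1)) -> attainable k m f.
Proof.
move=> hM hB base; elim: m => [|m IH].
  rewrite leqn0 => /eqP M0 f; rewrite M0 subnn addn0 -M0; exact: base.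
rewrite leq_eqVlt => /orP[/eqP <- f | Mm f]; first by rewrite subnn addn0; apply: base.
have {}IH := IH Mm.
have mono : 'C(M, d.+1) <= 'C(m, d.+1) by apply: leq_bin2l.
have hBm : 'C(m, d) <= B + ('C(m, d.+1) - 'C(M, d.+1)).
  elim: m Mm mono {IH} => [|m IH'] Mm mono; first by rewrite /d bin0n.
  move: Mm; rewrite ltnS leq_eqVlt => /orP[/eqP <- |Mm]; first by rewrite subnn addn0.
  have mono' : 'C(M, d.+1) <= 'C(m, d.+1) by apply: leq_bin2l.
  have := IH' Mm mono'; have : 'C(m, k) <= 'C(m, d) by apply: leq_binS; lia.
  by rewrite /d !binS -/d; lia.
rewrite binS => hf.
have [lt | ge] := ltnP f (B + ('C(m, d.+1) - 'C(M, d.+1))).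
  by apply: attainable_skip (IH f lt).
have h : f - 'C(m, d) < B + ('C(m, d.+1) - 'C(M, d.+1)) by lia.
have := attainable_add (IH _ h); rewrite subnK //; lia.
Qed.

(** Small values are attained on M = d + 4 d^2 + x vertices with x <= d (d + 3),
    so M (r + 1) <= 5 r^2 * r for r = d + 1, and extension together with
    complementation reaches everything. *)
Lemma all_attainable k m f : 0 < k -> 5 * k.+2 ^ 2 <= m -> f <= 'C(m, k.+2) ->
  attainable k m f.
Proof.
move=> k0 hm hf; set d := k.+1; set v := (2 * d) ^ 2.
have v0 : 0 < v by rewrite expn_gt0.
set x := trunc_log 2 (v ^ d).
have xl : 2 ^ x <= v ^ d by apply: trunc_logP; rewrite ?expn_gt0 ?v0.
have xu : v ^ d < 2 ^ x.+1 by apply: trunc_log_ltn.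
have xd : x <= d * (d + 3).
  rewrite -(@leq_exp2l 2) //; apply: (leq_trans xl).
  rewrite mulnC expnM leq_expn2r // /v expnMn (_ : d + 3 = 2 + d.+1); last by lia.
  by rewrite expnD leq_mul2l sqr_leq_exp2 orbT.
pose M := d + v + x.
have vE : v = 4 * d ^ 2 by rewrite /v expnMn.
have Mm : M * d.+2 <= m * d.+1.
  have : M <= 5 * d ^ 2 + 4 * d by rewrite /M vE; nia.
  rewrite -/d in hm *; nia.
have dbl := double_bin (ltn0Sn d) Mm.
have ext := @attainable_extend k M m 'C(d + v, d.+1) _ (leq_bin_shift (ltn0Sn k) erefl xl)
  (fun f => @attainable_small k x f xu) _.
have Mdm : M <= m by nia.
have {}ext := ext _ Mdm.
have h2 : 2 * k.+1 <= M.+1 by rewrite /M vE -/d; nia.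
have {}ext := ext h2.
have B0 : 0 < 'C(d + v, d.+1) by rewrite bin_gt0; lia.
have le : 'C(d + v, d.+1) <= 'C(M, d.+1) by apply: leq_bin2l; rewrite leq_addr.
have [lt | ge] := ltnP f ('C(d + v, d.+1) + ('C(m, d.+1) - 'C(M, d.+1))); first exact: ext.
rewrite -(subKn hf); apply: attainable_compl; apply: ext.
rewrite -/d; lia.
Qed.

(** * Caterpillars in ordered graphs *)

(** Sequences carry the order: only values G x y with x before y matter, and G
    need not be symmetric. *)
Inductive realizes (T : eqType) (G : rel T) : word -> seq T -> Prop :=
| RealizesNil : realizes G [::] [::]
| RealizesLeft b w v u : all (fun y => G v y == b) u -> realizes G w u ->
    realizes G ((Leftmost, b) :: w) (v :: u)
| RealizesRight b w v u : all (fun y => G y v == b) u -> realizes G w u ->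
    realizes G ((Rightmost, b) :: w) (rcons u v).

Section Caterpillar.
Variable T : eqType.
Implicit Types (G : rel T) (s u : seq T).

Definition constant_on G b u := pairwise (fun x y => G x y == b) u.

Let neqb (a b : bool) : (a == ~~ b) = ~~ (a == b).
Proof. by case: a b => [] []. Qed.

(** If no vertex has D forward G-neighbours of colour b, keep the first vertex,
    discard its fewer than D neighbours of colour b, and repeat h times. *)
Lemma star_or_constant G b h D s : 0 < D -> h * D <= size s ->
  (exists u, [/\ subseq u s, size u = h & constant_on G (~~ b) u]) \/
  (exists v u, [/\ subseq (v :: u) s, D <= size u & all (fun y => G v y == b) u]).
Proof.
move=> D0; elim: h s => [|h IH] s hs; first by left; exists [::]; split=> //; exact: sub0seq.
case: s hs => [|v s] /=; first by lia.
rewrite mulSn => hs.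
have [big | small] := leqP D (size [seq y <- s | G v y == b]).
  right; exists v, [seq y <- s | G v y == b].
  by rewrite filter_all /= eqxx filter_subseq.
have cmp : [seq y <- s | G v y == ~~ b] = [seq y <- s | predC (fun y => G v y == b) y].
  by apply: eq_filter => y /=; exact: neqb.
have := count_predC (fun y => G v y == b) s; rewrite -!size_filter -cmp => hc.
case: (IH [seq y <- s | G v y == ~~ b]); first by lia.
  move=> [u [us su hu]]; left; exists (v :: u); split=> [|/=|].
  - by rewrite /= eqxx (subseq_trans us) ?filter_subseq.
  - by rewrite su.
  - rewrite /constant_on /= -/(constant_on _ _ _) hu andbT.
    by apply/allP => y /(mem_subseq us); rewrite mem_filter => /andP[].
move=> [x [u [us su hu]]]; right; exists x, u; split=> //.
exact: (subseq_trans us (subseq_trans (filter_subseq _ s) (subseq_cons s v))).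
Qed.

Lemma constant_on_rev G b u :
  constant_on G b (rev u) = constant_on (fun x y => G y x) b u.
Proof.
rewrite /constant_on; elim: u => //= x u IH.
by rewrite rev_cons -cats1 pairwise_cat /= andbT IH /allrel all_rev; congr (_ && _);
  apply: eq_all => y /=; rewrite andbT.
Qed.

(** Each letter costs one factor h of the available vertices; a right vertex is a
    left vertex of the reversed sequence. *)
Lemma constant_or_realizes G h w s : h ^ size w <= size s ->
  (exists b u, [/\ subseq u s, size u = h & constant_on G b u]) \/
  (exists2 u, subseq u s & realizes G w u).
Proof.
have [-> _|h0] := posnP h; first by left; exists true, [::]; split=> //; exact: sub0seq.
elim: w s => [|[sd b] w IH] s /=.
  by move=> _; right; exists [::]; [exact: sub0seq | constructor].
rewrite expnS => hs; have D0 : 0 < h ^ size w by rewrite expn_gt0 h0.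
case: sd.
- case: (star_or_constant G b D0 hs) => [[u hu]|[v [s' [sub big adj]]]].
    by left; exists (~~ b), u.
  case: (IH s' big) => [[c [u [us su hu]]]|[u us hu]].
    left; exists c, u; split=> //; apply: (subseq_trans us).
    exact: subseq_trans (subseq_cons _ _) sub.
  right; exists (v :: u); first by apply: subseq_trans sub; rewrite /= eqxx.
  by apply: RealizesLeft => //; apply/allP => y /(mem_subseq us); exact: (allP adj).
- rewrite -(size_rev s) in hs.
  case: (star_or_constant (fun x y => G y x) b D0 hs) => [[u [us su hu]]|[v [s' [sub big adj]]]].
    left; exists (~~ b), (rev u); rewrite size_rev constant_on_rev; split=> //.
    by rewrite -subseq_rev revK.
  rewrite -(size_rev s') in big.
  rewrite -subseq_rev revK rev_cons in sub.
  case: (IH (rev s') big) => [[c [u [us su hu]]]|[u us hu]].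
    left; exists c, u; split=> //; apply: (subseq_trans us).
    exact: subseq_trans (subseq_rcons _ _) sub.
  right; exists (rcons u v); first by apply: subseq_trans sub; rewrite -!cats1 subseq_cat2r.
  by apply: RealizesRight => //; apply/allP => y /(mem_subseq us);
    rewrite mem_rev; exact: (allP adj).
Qed.

(** Pairs x, y are counted with the number of ways to choose k later vertices,
    among the rest of the sequence and q vertices beyond its end. *)
Fixpoint row_count G k x u q :=
  if u is y :: u' then G x y * 'C(size u' + q, k) + row_count G k x u' q else 0.
Fixpoint pair_count G k u q :=
  if u is x :: u' then row_count G k x u' q + pair_count G k u' q else 0.

Lemma row_count_all G k x u q b : all (fun y => G x y == b) u ->
  row_count G k x u q = b * ('C(size u + q, k.+1) - 'C(q, k.+1)).
Proof.
elim: u => [|y u IH] /=; first by rewrite add0n subnn muln0.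
case/andP => /eqP xy /IH ->; rewrite xy addSn binS.
have : 'C(q, k.+1) <= 'C(size u + q, k.+1) by apply: leq_bin2l; lia.
by move=> h; rewrite -mulnDr; congr (_ * _); lia.
Qed.

Lemma row_count_rcons G k x u v q :
  row_count G k x (rcons u v) q = row_count G k x u q.+1 + G x v * 'C(q, k).
Proof. by elim: u => [|y u IH] /=; rewrite ?addn0 // IH size_rcons addSnnS addnA. Qed.

Lemma pair_count_rcons G k u v q b : all (fun y => G y v == b) u ->
  pair_count G k (rcons u v) q = pair_count G k u q.+1 + b * (size u * 'C(q, k)).
Proof.
elim: u => [|x u IH] /=; first by rewrite muln0.
by case/andP => /eqP xv /IH ->; rewrite row_count_rcons xv; lia.
Qed.

Lemma realizes_size G w u : realizes G w u -> size u = size w.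
Proof. by elim=> //= b w' v u' _ _ IH; rewrite ?size_rcons IH. Qed.

Lemma pair_count_realizes G k w u q : realizes G w u -> pair_count G k u q = weight k w q.
Proof.
move=> R; elim: R q => //= b w' v u' adj R IH q.
  by rewrite (row_count_all _ _ adj) IH (realizes_size R).
by rewrite (pair_count_rcons _ _ adj) IH (realizes_size R) addnC.
Qed.
End Caterpillar.

(** * Counting edges *)

Section Count.
Import mathcomp.boot.fintype mathcomp.boot.finset.
Variables (k : nat) (V : finType) (E : {set {set V}}) (G : rel V).
Hypothesis unif : forall e : {set V}, e \in E -> #|e| = k.+2.

Definition edges_through (A : {set V}) (u : seq V) : nat :=
  #|[set e in E | (A \subset e) && (e \subset A :|: [set x in u])]|.

(** Deciding whether y belongs to the edge moves y into A or discards it; run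
    along u, this sorts the edges by their first two vertices. *)
Lemma edges_through_cons (A : {set V}) y (u : seq V) : y \notin A -> y \notin u ->
  edges_through A (y :: u) = edges_through (y |: A) u + edges_through A u.
Proof.
move=> yA yu; rewrite /edges_through.
rewrite -(cardsID [set e : {set V} | y \in e]); congr (_ + _); apply: eq_card => e; rewrite !inE.
- rewrite -andbA; congr (_ && _); rewrite subUset sub1set set_cons.
  by rewrite setUCA setUA andbC andbA.
- case: (e \in E) => //=; last by rewrite andbF.
  case ye: (y \in e) => /=.
    apply/esym/negbTE/negP => /andP[_ /subsetP /(_ _ ye)].
    by rewrite !inE (negbTE yA) (negbTE yu).
  congr (_ && _); apply/subsetP/subsetP => h x xe; have := h x xe; rewrite !inE.
    by case/or3P => [->|/eqP xy|->]; rewrite ?orbT //; rewrite xy ye in xe.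
  by case/orP => ->; rewrite ?orbT.
Qed.

Lemma edges_through_pair x y u : uniq [:: x, y & u] ->
  (forall c, subseq c u -> size c = k -> ([set z in [:: x, y & c]] \in E) = G x y) ->
  edges_through [set x; y] u = G x y * 'C(size u, k).
Proof.
move=> /= /and3P[]; rewrite inE negb_or => /andP[xy xu] yu uu det.
have mk (A : {set V}) : A \subset [set z in u] -> #|A| = k ->
    ([set x; y] :|: A \in E) = G x y.
  move=> Au Ak.
  rewrite -(det [seq z <- u | z \in A]) ?filter_subseq //.
    congr (_ \in E); apply/setP => z; rewrite !inE mem_filter orbA.
    case zA: (z \in A); last by rewrite !orbF.
    by have := subsetP Au z zA; rewrite inE => ->.
  rewrite -Ak -(card_uniqP (filter_uniq _ uu)); apply: eq_card => z; rewrite mem_filter.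
  case zA: (z \in A) => //=.
  by have := subsetP Au z zA; rewrite inE => ->.
have xyA (A : {set V}) : A \subset [set z in u] -> [set x; y] :&: A = set0.
  move=> Au; apply/setP => z; rewrite !inE; apply/negP => /andP[/orP[] /eqP -> /(subsetP Au)].
    by rewrite inE (negbTE xu).
  by rewrite inE (negbTE yu).
have splitU (e : {set V}) : [set x; y] \subset e -> [set x; y] :|: (e :\: [set x; y]) = e.
  by move=> se; rewrite -[in RHS](setID e [set x; y]) (setIidPr se).
have removeU (A : {set V}) : A \subset [set z in u] -> ([set x; y] :|: A) :\: [set x; y] = A.
  move=> /xyA /setP xyA0; apply/setP => z; have := xyA0 z; rewrite !inE.
  by case: (z == x); case: (z == y); case: (z \in A).
have cu : #|[set z in u]| = size u by rewrite cardsE; apply/card_uniqP.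
rewrite -cu -(cards_draws [set z in u] k) /edges_through.
case Gxy: (G x y); last first.
  rewrite mul0n; apply: eq_card0 => e; rewrite !inE; apply/negP => /and3P[eE se es].
  have := mk (e :\: [set x; y]); rewrite (splitU _ se) eE Gxy => H.
  have sub : e :\: [set x; y] \subset [set z in u] by rewrite subDset.
  have := H sub; rewrite cardsD (setIidPr se) cards2 xy (unif eE) /= subn2 /= => F.
  by have := F erefl.
rewrite mul1n -(card_in_imset (f := fun A => [set x; y] :|: A)); last first.
  move=> A B; rewrite !inE => /andP[Au _] /andP[Bu _] AB.
  by rewrite -(removeU _ Au) AB removeU.
apply: eq_card => e; rewrite !inE; apply/idP/imsetP.
  move=> /and3P[eE se es]; exists (e :\: [set x; y]); last by rewrite splitU.
  by rewrite !inE subDset es /= cardsD (setIidPr se) cards2 xy (unif eE) /= subn2.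
move=> [A]; rewrite !inE => /andP[Au /eqP Ak] ->.
by rewrite mk // Gxy subsetUl /= setUS.
Qed.

Definition first_two_decide (s : seq V) := forall x y c, size c = k -> subseq [:: x, y & c] s ->
  ([set z in [:: x, y & c]] \in E) = G x y.

Lemma edges_through_row x u : uniq (x :: u) -> first_two_decide (x :: u) ->
  edges_through [set x] u = row_count G k x u 0.
Proof.
elim: u => [|y u IH] /= un det.
  apply: eq_card0 => e; rewrite !inE; apply/negP => /and3P[eE _ /subset_leq_card].
  rewrite (unif eE) => h.
  have : #|[set x] :|: [set z in [::]]| <= 1.
    by rewrite -(cards1 x); apply: subset_leq_card; apply/subsetP => z; rewrite !inE orbF.
  by move/(leq_trans h).
move: (un) => /andP[]; rewrite inE negb_or => /andP[xy xu] /andP[yu uu].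
rewrite edges_through_cons ?inE 1?eq_sym // IH /= ?xu //; last first.
  move=> a b c sc sub; apply: det => //; apply: (subseq_trans sub).
  rewrite /= eqxx; exact: subseq_cons.
rewrite [y |: _]setUC edges_through_pair ?addn0 //=; last first.
  by move=> c sub sc; apply: det => //=; rewrite !eqxx.
Qed.

Lemma edges_through_count u : uniq u -> first_two_decide u ->
  edges_through set0 u = pair_count G k u 0.
Proof.
elim: u => [|x u IH] un det.
  apply: eq_card0 => e; rewrite !inE; apply/negP => /and3P[eE _ /subset_leq_card].
  rewrite (unif eE) => h.
  have : #|set0 :|: [set z in [::]] : {set V}| <= 0.
    by rewrite leqn0 cards_eq0; apply/eqP/setP => z; rewrite !inE.
  by move/(leq_trans h).
have [xu uu] := andP un.
rewrite edges_through_cons ?inE //= setU0 edges_through_row // IH //.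
by move=> a b c sc sub; apply: det => //; apply: (subseq_trans sub); exact: subseq_cons.
Qed.
End Count.

(** * Erdos-Rado stepping down *)

Section EndHomogeneous.
Variable T : eqType.

Fixpoint words k (p : seq T) : seq (seq T) :=
  if k is k'.+1 then [seq x :: c | x <- p, c <- words k' p] else [:: [::]].

Lemma size_words k p : size (words k p) = size p ^ k.
Proof. by elim: k => //= k IH; rewrite size_allpairs IH expnS. Qed.

Lemma mem_words k p c : size c = k -> {subset c <= p} -> c \in words k p.
Proof.
elim: c k => [|x c IH] [|k] //= [sc] sub; apply: allpairs_f.
  by apply: sub; rewrite mem_head.
by apply: IH => // y yc; apply: sub; rewrite inE yc orbT.
Qed.

Lemma common_refinement (I : eqType) (L : seq I) (p : I -> T -> bool) b s :
  2 ^ size L * b <= size s ->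
  exists s', [/\ subseq s' s, b <= size s' &
    forall i, i \in L -> {in s' &, forall y z, p i y = p i z}].
Proof.
elim: L s => [|i L IH] s /=; first by rewrite mul1n => h; exists s; split.
rewrite expnS -mulnA => h.
have [e he] : exists e, 2 ^ size L * b <= size [seq y <- s | p i y == e].
  have := count_predC (fun y => p i y == true) s; rewrite -!size_filter.
  have -> : [seq y <- s | predC (fun y => p i y == true) y] = [seq y <- s | p i y == false].
    by apply: eq_filter => y /=; case: (p i y).
  move=> hs; have [l|g] := leqP (2 ^ size L * b) (size [seq y <- s | p i y == true]).
    by exists true.
  by exists false; move: h hs g; lia.
have [s' [sub sz hL]] := IH _ he.
exists s'; split=> //; first exact: subseq_trans sub (filter_subseq _ _).
move=> j; rewrite inE => /orP[/eqP -> y z ys zs|/hL //].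
move: (mem_subseq sub ys) (mem_subseq sub zs).
by rewrite !mem_filter => /andP[/eqP -> _] /andP[/eqP -> _].
Qed.

(** Choose the first available vertex, then shrink the remaining ones so that the
    colour of every k-word over the chosen vertices, extended by a remaining
    vertex y, no longer depends on y.  There are at most N^k words, so each choice
    costs a factor 2^(N^k). *)
Lemma end_homogeneous_aux (col : seq T -> bool) k N n pre s :
  size pre + n <= N -> 2 ^ (n * (N ^ k).+1) <= size s ->
  (forall c, size c = k -> {subset c <= pre} ->
     {in s &, forall y z, col (rcons c y) = col (rcons c z)}) ->
  exists u, [/\ subseq u s, size u = n & forall a b, u = a ++ b ->
     forall c, size c = k -> {subset c <= pre ++ a} ->
     {in b &, forall y z, col (rcons c y) = col (rcons c z)}].
Proof.
elim: n pre s => [|n IH] pre s hN hs inv.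
  by exists [::]; split=> [|//|[|? ?] [|? ?] // _ c _ _ y z]; first exact: sub0seq.
case: s hs inv => [|x s]; first by rewrite leqNgt expn_gt0.
move=> hs inv.
have hs' : 2 ^ size (words k (rcons pre x)) * 2 ^ (n * (N ^ k).+1) <= size s.
  have h1 : size (words k (rcons pre x)) <= N ^ k.
    rewrite size_words size_rcons; case: (k) => // k'; rewrite leq_exp2r //; lia.
  rewrite -ltnS; apply: leq_trans hs; rewrite mulSn addSn expnS -expnD.
  have : 2 ^ (size (words k (rcons pre x)) + n * (N ^ k).+1) <= 2 ^ (N ^ k + n * (N ^ k).+1).
    by rewrite leq_exp2l // leq_add2r.
  have : 0 < 2 ^ (N ^ k + n * (N ^ k).+1) by rewrite expn_gt0.
  by lia.
have [s' [sub sz hom]] := common_refinement (fun c y => col (rcons c y)) hs'.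
have inv' c : size c = k -> {subset c <= rcons pre x} ->
     {in s' &, forall y z, col (rcons c y) = col (rcons c z)}.
  by move=> sc cp; apply: hom; apply: mem_words.
have [u [us su hu]] := IH (rcons pre x) s' (ltac:(by rewrite size_rcons; lia)) sz inv'.
exists (x :: u); split=> /=; [by rewrite eqxx (subseq_trans us sub) | by rewrite su |].
move=> [|y a] b /=.
  move=> <- c sc; rewrite cats0 => cp y z yu zu; apply: (inv c) => //.
    by move: y yu; apply: mem_subseq; rewrite /= eqxx (subseq_trans us sub).
  by move: z zu; apply: mem_subseq; rewrite /= eqxx (subseq_trans us sub).
by case=> <- /hu H c sc; rewrite -cat_rcons; apply: H.
Qed.

Lemma subseq_rcons_split c (y : T) u : subseq (rcons c y) u ->
  exists a b, [/\ u = a ++ b, subseq c a & y \in b].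
Proof.
elim: u c => [|v u IH] [|x c] //=.
  by move=> h; exists [::], (v :: u); split=> //; move: h; rewrite -sub1seq.
case: ifP => [/eqP -> | xv] /=.
  by move=> /IH[a [b [-> ca yb]]]; exists (v :: a), b; rewrite /= eqxx.
rewrite -rcons_cons => /IH[a [b [-> ca yb]]]; exists (v :: a), b; split=> //=.
by rewrite xv.
Qed.

(** The last vertex l serves as a common continuation of all k-words, so that the
    colour of a (k + 1)-word becomes a colour of its first k letters. *)
Lemma end_homogeneous (col : seq T -> bool) k n s : 0 < k ->
  2 ^ (n.+1 * (n.+1 ^ k).+1) <= size s ->
  exists u l, [/\ subseq u s, size u = n & forall c y, size c = k ->
     subseq (rcons c y) u -> col (rcons c y) = col (rcons c l)].
Proof.
move=> k0 hs.
have [|u [us su hu]] := @end_homogeneous_aux col k n.+1 n.+1 [::] s (leqnn _) hs.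
  by move=> c sc; case: c sc => [|x c _ /(_ x (mem_head _ _))] //= k00; rewrite -k00 in k0.
case/lastP: u us su hu => // u l us; rewrite size_rcons => -[su] hu.
exists u, l; split=> //; first by apply: subseq_trans us; apply: subseq_rcons.
move=> c y sc /subseq_rcons_split[a [b [ub ca yb]]].
apply: (hu a (rcons b l)); rewrite ?ub ?rcons_cat ?mem_rcons ?inE ?eqxx ?yb ?orbT //.
exact: mem_subseq.
Qed.
End EndHomogeneous.

Definition tower j y := iter j (expn 2) y.

Lemma tower_geq j y : y <= tower j y.
Proof. by elim: j => //= j IH; apply: (leq_trans IH); apply/ltnW/ltn_expl. Qed.

(** Powers can be pushed to the bottom of a tower, so polynomial losses in each
    stepping-down round only enlarge the exponent D below. *)
Lemma tower_expn j y a : 1 < y -> 0 < a -> tower j y ^ a <= tower j (y ^ a).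
Proof.
move=> y1 a0; elim: j => //= j IH; rewrite -expnM leq_exp2l //.
apply: leq_trans IH; have := leq_trans y1 (tower_geq j y).
move: (tower j y) => z z1; case: a a0 => // a _.
rewrite expnS leq_mul2l; apply/orP; right.
by apply: leq_trans (ltn_expl a z1).
Qed.

(** The colour of (j + 2)-words is stepped down j times; the induction hypothesis is
    applied to the colouring of shorter words obtained by appending l. *)
Lemma first_two_determine j : exists2 D, 0 < D & forall (T : eqType) (col : seq T -> bool) s t,
  1 < t -> tower j (t ^ D) <= size s -> exists u (G : rel T), [/\ subseq u s, t <= size u &
    forall x y c, size c = j -> subseq (x :: y :: c) u -> col (x :: y :: c) = G x y].
Proof.
elim: j => [|j [D D0 IH]].
  exists 1 => // T col s t _; rewrite expn1 /= => ts.
  by exists s, (fun x y => col [:: x; y]); split=> // x y c /size0nil ->.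
exists (D * (2 * j.+4)) => [|T col s t t1 hs]; first by rewrite muln_gt0 D0.
set n := tower j (t ^ D).
have tD1 : 1 < t ^ D by apply: (leq_trans t1); rewrite -{1}[t]expn1 leq_pexp2l // ltnW.
have n1 : 1 < n by apply: leq_trans (tower_geq _ _).
have hn : 2 ^ (n.+1 * (n.+1 ^ j.+2).+1) <= size s.
  apply: leq_trans hs; rewrite /= leq_exp2l // expnM.
  apply: leq_trans (tower_expn j tD1 _); last by lia.
  rewrite -/n expnM; apply: (@leq_trans (n.+1 ^ j.+4)).
    rewrite [leqRHS]expnS leq_mul2l /= [leqRHS]expnS.
    have : 0 < n.+1 ^ j.+2 by rewrite expn_gt0.
    move: (_ ^ _) => z; nia.
  by rewrite leq_exp2r // expnS expn1; nia.
have [u [l [us su hu]]] := end_homogeneous col (ltn0Sn j.+1) hn.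
have [u' [G [u's tu' hG]]] := IH T (fun c => col (rcons c l)) u t t1 (ltac:(by rewrite su)).
exists u', G; split=> //; first exact: subseq_trans u's us.
move=> x y c; case/lastP: c => // c z; rewrite size_rcons => -[sc] sub.
have := hu (x :: y :: c) z; rewrite /= sc => -> //; last exact: subseq_trans sub u's.
apply: hG => //; apply: subseq_trans sub; rewrite -!rcons_cons; exact: subseq_rcons.
Qed.

(** * Homogeneous sets and forbidden subsets *)

Section Hypergraph.
Import mathcomp.boot.fintype mathcomp.boot.finset.
Variables (k : nat) (V : finType) (H : uniform_hypergraph k.+2 V) (G : rel V).

Lemma homogeneous_constant_on b s : uniq s -> first_two_decide k (edges H) G s ->
  constant_on G b s -> homogeneous H [set x in s].
Proof.
move=> us det con.
have key (e : {set V}) : e \subset [set x in s] -> #|e| = k.+2 -> (e \in edges H) = b.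
  move=> es ek.
  have eE : e = [set x in [seq x <- s | x \in e]].
    apply/setP => x; rewrite inE mem_filter.
    by case xe: (x \in e) => //=; have := subsetP es x xe; rewrite inE => ->.
  have sz : size [seq x <- s | x \in e] = k.+2.
    by rewrite -ek [in RHS]eE cardsE; apply/esym/card_uniqP/filter_uniq.
  rewrite eE; have sub : subseq [seq x <- s | x \in e] s by exact: filter_subseq.
  case: [seq x <- s | x \in e] sz sub => [|x [|y c]] //= [sc] sub.
  rewrite (det x y c sc sub).
  by have := subseq_pairwise sub con; rewrite /= => /andP[/andP[/eqP]].
case: b con key => con key; [left | right] => e es ek; by rewrite key.
Qed.

Lemma mf_subset_realizes w m f s : uniq s -> first_two_decide k (edges H) G s ->
  realizes G w s -> size w = m -> weight k w 0 = f -> mf_subset H m f [set x in s].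
Proof.
move=> us det R sw wf; split.
  by rewrite cardsE (card_uniqP us) (realizes_size R).
rewrite -wf -(pair_count_realizes k 0 R) -(edges_through_count (@edges_uniform _ _ H) us det).
by apply: eq_card => e; rewrite !inE sub0set set0U.
Qed.
End Hypergraph.

(** * Bounds for iterated logarithms *)

Section RealBounds.
Variable R : realType.
Local Open Scope ring_scope.

Lemma log2_leq (x : R) (z : nat) : x <= (2 ^ z)%N%:R -> log2 x <= z%:R.
Proof.
move=> h; have l2 : 0 < ln 2 :> R by rewrite ln_gt0 // ltr1n.
rewrite /log2 ler_pdivrMr //; have [x0 | x0] := ltP 0 x; last first.
  by rewrite ln0 // mulr_ge0 // ltW.
rewrite mulrC mulr_natr -lnXn // ler_ln ?posrE ?exprn_gt0 //.
by rewrite -natrX.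
Qed.

Lemma iter_log2_leq j (x : R) (y : nat) : x <= (tower j y)%:R -> iter_log2 j x <= y%:R.
Proof.
rewrite /iter_log2; elim: j x => [|j IH] x //= h.
by rewrite -iterS iterSr; apply: IH; apply: log2_leq.
Qed.

(** The exponent 1 / (2 D m) turns (h + 1)^(m D) into the square root of h + 1,
    which is at most h once h >= 2; the square root makes up for rounding t down
    to an m-th power.  A negative L has L `^ p = 1 by convention. *)
Lemma powR_half_leq (L : R) (D m h : nat) : (0 < D)%N -> (0 < m)%N -> (1 < h)%N ->
  L <= ((h.+1 ^ m) ^ D)%N%:R -> L `^ ((2 * D%:R)^-1 / m%:R) <= h%:R.
Proof.
move=> D0 m0 h1 hL.
have D0' : 0 < D%:R :> R by rewrite ltr0n.
have m0' : 0 < m%:R :> R by rewrite ltr0n.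
have p0 : 0 <= (2 * D%:R)^-1 / m%:R :> R by rewrite divr_ge0 ?invr_ge0 ?mulr_ge0 // ltW.
have [L0 | L0] := leP 0 L; last first.
  rewrite /powR lt_eqF // ln0 ?ltW // mulr0 expR0.
  by rewrite ltr1n.
apply: (le_trans (ge0_ler_powR p0 L0 _ hL)); first by rewrite nnegrE ler0n.
rewrite -expnM natrX -powR_mulrn ?ler0n // -powRrM natrM.
have -> : m%:R * D%:R * ((2 * D%:R)^-1 / m%:R) = 2^-1 :> R.
  by field; rewrite !gt_eqF.
have h2 : (h.+1)%:R <= (h%:R) ^+ 2 :> R by rewrite -natrX ler_nat; nia.
apply: (le_trans (ge0_ler_powR _ _ _ h2)); rewrite ?invr_ge0 ?nnegrE ?exprn_ge0 //.
by rewrite -powR_mulrn ?ler0n // -powRrM mulfV ?pnatr_eq0 // powRr1.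
Qed.
End RealBounds.

(** * The theorem *)

Theorem theorem1p1 (R : realType) (r : nat) (hr : (3 <= r)%N) :
  exists2 a : R, (0 < a)%R &
    forall m f : nat, (5 * r ^ 2 <= m)%N -> (f <= 'C(m, r))%N ->
    exists N : nat, forall n : nat, (N <= n)%N ->
    forall (V : finType) (H : uniform_hypergraph r V), #|V| = n ->
      (forall S : {set V}, ~ mf_subset H m f S) ->
      exists2 S : {set V}, homogeneous H S &
        (iter_log2 (r - 2) n%:R `^ (a / m%:R) <= #|S|%:R :> R)%R.
Proof.
case: r hr => [|[|k]] // hr; have k0 : 0 < k by lia.
have [D D0 decide] := first_two_determine k.
exists ((2 * D%:R)^-1)%R; first by rewrite invr_gt0 mulr_gt0 // ltr0n.
move=> m f hm hf; have m0 : 0 < m by nia.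
have [w sw wf] := all_attainable k0 hm hf.
pose T h := tower k ((h ^ m) ^ D).
exists (T 2) => n hn V H Vn noS.
have bounded h : T h <= n -> h <= n.
  apply: leq_trans; apply: leq_trans (tower_geq _ _).
  rewrite -expnM; have mD : 0 < m * D by rewrite muln_gt0 m0.
  by case: h => // h; rewrite -{1}[h.+1]expn1 leq_pexp2l.
(* The largest h whose m-th power can be guaranteed as the length of the
   sequence; the next value h + 1 bounds the iterated logarithm of n. *)
have [h hT hmax] := ex_maxnP (ex_intro (fun h => T h <= n) 2 hn) bounded.
have h1 : 1 < h := hmax 2 hn.
have t1 : 1 < h ^ m.
  apply: (leq_trans h1); rewrite -{1}[h]expn1 leq_pexp2l // ltnW //.
have [|s [G [sV ts det]]] := decide V (fun c => [set x in c] \in edges H) (enum V) _ t1.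
  by rewrite -cardE Vn.
have us : uniq s := subseq_uniq sV (enum_uniq V).
have sub_det u : subseq u s -> first_two_decide k (edges H) G u.
  by move=> us' x y c sc sub; apply: det => //; apply: subseq_trans sub us'.
rewrite -sw in ts.
case: (constant_or_realizes G ts) => [[b [u [us' uh con]]] | [u us' R']]; last first.
  by case: (noS [set x in u]); apply: mf_subset_realizes R' sw wf;
     [exact: subseq_uniq us' us | exact: sub_det].
have uu := subseq_uniq us' us.
exists [set x in u]; first exact: homogeneous_constant_on uu (sub_det u us') con.
rewrite finset.cardsE (card_uniqP uu) uh subn2 /=.
apply: powR_half_leq => //; apply: iter_log2_leq; rewrite ler_nat ltnW //.
by rewrite ltnNge; apply/negP => /hmax; rewrite ltnn.
Qed.
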